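(* Let $G$ be a connected graph with at least 3 vertices. Then $\mathrm{Sing}(X_G)$ has a $c_1$ invariant; that is, for every prime power $q$, the number of $\mathbb{F}_q$-points of $\mathrm{Sing}(X_G)$ is divisible by $q$.
   Context: Graphs are finite (multi)graphs; $N_G$ is the number of edges of $G$. The graph polynomial is $\Psi_G(x)=\sum_T\prod_{e\notin T}x_e$, the sum being over spanning trees $T$ of $G$, with one variable $x_e$ per edge. $X_G\subset\mathbb{A}^{N_G}$ is the affine hypersurface $\Psi_G=0$ (over $\mathbb{Z}$), and $\mathrm{Sing}(X_G)\subset\mathbb{A}^{N_G}$ is its singular locus, defined by the vanishing of $\Psi_G$ and of all partial derivatives $\partial\Psi_G/\partial x_e$, $e\in E(G)$. A scheme $X$ of finite type over $\mathrm{Spec}\,\mathbb{Z}$ is said to have a $c_n$ invariant ($n\ge 0$) if $|X(\mathbb{F}_q)|\equiv 0 \bmod q^n$ for all prime powers $q$. *)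

(* Defs.v *)
From mathcomp Require Import all_boot all_order all_algebra.
From mathcomp Require Import mpoly.

Set Implicit Arguments.
Unset Strict Implicit.
Unset Printing Implicit Defensive.

Import GRing.Theory.
Local Open Scope ring_scope.

(* Finite multigraphs: loops and parallel edges are allowed.  Edges are        *)
(* labelled by 'I_num_edges so that they can index the variables of a          *)
(* polynomial; the order of the two components of [ends e] is irrelevant.      *)
Record multigraph := Multigraph {
  vertex : finType;
  num_edges : nat;
  ends : 'I_num_edges -> vertex * vertex
}.

Section Multigraph.

Variable G : multigraph.
Local Notation V := (vertex G).
Local Notation E := 'I_(num_edges G).
Implicit Types (e : E) (u v : V) (T : {set E}).

Definition joins e u v := (ends e == (u, v)) || (ends e == (v, u)).

(* The spanning subgraph with edge set T. *)
Definition connected_by T :=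
  [forall u, forall v, connect [rel a b | [exists e in T, joins e a b]] u v].

Definition connected_graph := connected_by setT.

(* A cycle of length k + 1; [ordS] is the successor modulo k + 1.  A loop is a *)
(* cycle of length 1 and a pair of parallel edges is a cycle of length 2.      *)
Definition is_cycle k (v : {ffun 'I_k.+1 -> V}) (e : {ffun 'I_k.+1 -> E}) :=
  [&& injectiveb v, injectiveb e & [forall i, joins (e i) (v i) (v (ordS i))]].

(* Since the edges of a cycle are distinct, lengths above num_edges G do not   *)
(* occur, see acyclicP.                                                        *)
Definition acyclic T :=
  [forall k : E, forall v : {ffun 'I_k.+1 -> V}, forall e : {ffun 'I_k.+1 -> E},
     is_cycle v e ==> ~~ [forall i, e i \in T]].

Lemma acyclicP T :
  reflect (forall k (v : {ffun 'I_k.+1 -> V}) (e : {ffun 'I_k.+1 -> E}),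
             is_cycle v e -> exists i, e i \notin T)
          (acyclic T).
Proof.
apply: (iffP forallP) => [acT k v e vec | acT k].
  have lt_k : (k < num_edges G)%N.
    have /and3P[_ /injectiveP e_inj _] := vec.
    by have := leq_card e e_inj; rewrite !card_ord.
  have /forallP/(_ v)/forallP/(_ e)/implyP/(_ vec) := acT (Ordinal lt_k).
  by move=> /forallPn.
apply/forallP=> v; apply/forallP=> e; apply/implyP=> vec.
by apply/forallPn; apply: acT vec.
Qed.

Definition spanning_tree T := connected_by T && acyclic T.

Definition graph_poly : {mpoly int[num_edges G]} :=
  \sum_(T : {set E} | spanning_tree T) \prod_(e : E | e \notin T) 'X_e.

End Multigraph.

(* The closed subscheme of affine n-space over the integers cut out by a       *)
(* finite list of equations.                                                   *)
Definition affine_scheme n := seq {mpoly int[n]}.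

Definition points n (X : affine_scheme n) (F : finFieldType) :
    {set {ffun 'I_n -> F}} :=
  [set x : {ffun 'I_n -> F} |
    all (fun f : {mpoly int[n]} => (map_mpoly intr f).@[x] == 0) X].

(* Finite fields are, up to isomorphism, exactly the F_q for q a prime power.  *)
Definition has_c_invariant k n (X : affine_scheme n) : Prop :=
  forall F : finFieldType, (#|F| ^ k %| #|points X F|)%N.

Definition sing_locus (G : multigraph) : affine_scheme (num_edges G) :=
  graph_poly G :: [seq (graph_poly G)^`M(e) | e : 'I_(num_edges G)].

(* Main.v *)
Require Import Defs.
From mathcomp Require Import all_boot all_order all_algebra.
From mathcomp Require Import perm mxabelem mpoly.

Set Implicit Arguments.
Unset Strict Implicit.
Unset Printing Implicit Defensive.

Import GRing.Theory.
Local Open Scope ring_scope.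

(** Let N and V be the numbers of edges and vertices of G, let B be the oriented
    incidence matrix of G with the row of one root vertex removed, and let K(x)
    be the symmetric matrix with blocks diag(x), B^T, B, 0, of size N + W where
    W = V - 1 >= 2.

    The matrix-tree theorem ([matrix_tree]) says that det K(x) is the graph
    polynomial up to a sign.  Since the graph polynomial is affine in each x_e,
    its partial derivative at x is, up to the same sign, the difference of
    det K at x + delta_e and at x.  If K(x) has a one-dimensional kernel spanned
    by z, all these derivatives can vanish only if z_e = 0 for every edge e, and
    then z is a potential that is constant along edges and zero at the root,
    hence zero as G is connected.  So the singular points are exactly the x for
    which K(x) has corank at least 2 ([in_sing_locus]).

    It remains to count these x modulo q.  This works for every symmetric matrix
    S of size m + w with w >= 2 whose lower right w x w block vanishes, with m
    variables added on the first m diagonal entries: the number of values for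
    which the corank is at least 2 is congruent to 1 if m = 0 and to 0 otherwise
    ([sum_corank_ge2]).  The induction on m singles out the first variable t and
    writes the matrix as a border (s + t, b) of a matrix A that depends on the
    other variables:
    - a case analysis on the rank of A and on whether b is in its row space
      shows that, modulo q, the number of good t is
      [(A | b^T) has dependent rows] - [A has corank >= 2]
      ([sum_corank_ge2_fiber]);
    - the first bracket is summed by counting the pairs of a choice of the
      variables and a row vector killed by (A | b^T).  For a fixed x the number
      of such vectors is a power of q, which is 1 modulo q exactly when the rows
      are independent; for a fixed vector z the equations on each variable are
      affine, and the w >= 2 coordinates of z in the zero block are subject to
      a single further equation, so that the count vanishes modulo q
      ([sum_bordered_not_free]);
    - the second bracket is the induction hypothesis.
    Both terms are congruent to 1 if m = 1 and to 0 if m > 1, so they cancel. *)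

(** * Ranks of bordered matrices *)

Lemma rank_col_mx_row (K : fieldType) n p (u : 'rV[K]_n) (A : 'M[K]_(p, n)) :
  \rank (col_mx u A) = (\rank A + ~~ (u <= A)%MS)%N.
Proof.
rewrite -addsmxE; case: (boolP (u <= A)%MS) => uA /=.
  by rewrite addn0 (addsmx_idPr uA).
have cap0 : (u :&: A)%MS = 0.
  apply/eqP/rowV0P => w; rewrite sub_capmx => /andP[/sub_rVP[a ->]].
  have [->|nz_a] := eqVneq a 0; first by rewrite scale0r.
  by rewrite (eqmx_scale _ nz_a) (negPf uA).
have nz_u : u != 0 by apply: contraNneq uA => ->; apply: sub0mx.
by have := mxrank_sum_cap u A; rewrite cap0 mxrank0 rank_rV nz_u addn0 addnC.
Qed.

Lemma rank_row_mx_tr (K : fieldType) n p (u : 'rV[K]_n) (A : 'M[K]_(p, n)) :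
  \rank (row_mx A^T u^T) = (\rank A + ~~ (u <= A)%MS)%N.
Proof. by rewrite -rank_col_mx_row -mxrank_tr tr_row_mx !trmxK -!addsmxE addsmxC. Qed.

Section BorderedRank.
Variables (K : fieldType) (n : nat).
Implicit Types (A : 'M[K]_n) (b : 'rV[K]_n) (t : K).

Lemma rank_bordered_out A b t : A^T = A -> ~~ (b <= A)%MS ->
  \rank (block_mx t%:M b b^T A) = (\rank A).+2.
Proof.
move=> symA bA; rewrite block_mxEv rank_col_mx_row.
have -> : \rank (row_mx b^T A) = (\rank A).+1.
  by rewrite -mxrank_tr tr_row_mx trmxK symA rank_col_mx_row bA addn1.
case: submxP => [[y]|_]; last by rewrite addn1.
rewrite mul_mx_row => /eq_row_mx[_ eb].
by rewrite eb submxMl in bA.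
Qed.

Lemma rank_bordered_in A (w : 'rV_n) t : A^T = A ->
  \rank (block_mx t%:M (w *m A) (w *m A)^T A)
  = ((t != (w *m A *m w^T) 0 0)%R + \rank A)%N.
Proof.
move=> symA; set c := (w *m A *m w^T) 0 0.
pose L := block_mx 1%:M w 0 (1%:M : 'M_n).
have detL : L \in unitmx by rewrite unitmxE det_ublock !det1 mulr1 unitr1.
have -> : block_mx t%:M (w *m A) (w *m A)^T A
          = L *m block_mx (t - c)%:M 0 0 A *m L^T.
  rewrite /L tr_block_mx !trmx1 trmx0 !mulmx_block !mul1mx !mul0mx !mulmx0 !mulmx1.
  rewrite !add0r !addr0 trmx_mul symA [w *m A *m _]mx11_scalar -/c.
  by rewrite -raddfD /= subrK.
rewrite mxrankMfree ?row_free_unit ?unitmx_tr // eqmxMfull ?row_full_unit //.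
rewrite rank_diag_block_mx; congr (_ + _)%N; rewrite rank_rV; congr (~~ _).
rewrite -[t == c]subr_eq0; apply/eqP/eqP => [/matrixP/(_ 0 0)|->]; last exact: raddf0.
by rewrite !mxE eqxx.
Qed.
End BorderedRank.

(** * Counting modulo the order of a finite field *)

Definition partial_diag (R : nzRingType) m w (x : {ffun 'I_m -> R}) : 'M[R]_(m + w) :=
  diag_mx (row_mx (\row_i x i) 0).

(** Congruences modulo q are equalities in a ring where q vanishes, which allows
    subtraction of counts. *)
Section CountModQ.
Variables (F : finFieldType) (Z : comPzRingType) (q_eq0 : #|F|%:R = 0 :> Z).

Lemma sum_const_field (c : Z) : \sum_(t : F) c = 0.
Proof. by rewrite sumr_const cardT -cardE -mulr_natr q_eq0 mulr0. Qed.

Lemma sum_pred1_field (c : F) : \sum_(t : F) (t == c)%:R = 1 :> Z.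
Proof. by rewrite (bigD1 c) //= eqxx big1 ?addr0 // => t /negPf->. Qed.

(** The kernel has q ^ (m - rank) elements. *)
Lemma sum_kernel m p (M : 'M[F]_(m, p)) :
  \sum_(z : 'rV_m) (z *m M == 0)%:R = (row_free M)%:R :> Z.
Proof.
rewrite -natr_sum -big_mkcond sum1_card.
have -> : #|[pred z : 'rV_m | z *m M == 0]| = (#|F| ^ (m - \rank M))%N.
  by rewrite -mxrank_ker -card_rowg; apply: eq_card => z; rewrite !inE sub_kermx.
rewrite natrX q_eq0 expr0n subn_eq0 /row_free.
by rewrite eqn_leq rank_leq_row.
Qed.

(** If b is not in the row space of A, the bordered matrix has rank
    rank A + 2 whatever t is.  If it is, the matrix is congruent to a diagonal sum
    of A and t - d for some d, so that its rank drops for exactly one t, and this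
    single value is decisive only when A has corank 1. *)
Lemma sum_corank_ge2_fiber n (A : 'M[F]_n) (b : 'rV_n) s : A^T = A ->
  \sum_(t : F) (\rank (block_mx (s + t)%:M b b^T A) + 2 <= n.+1)%N%:R
  = (~~ row_free (row_mx A b^T))%:R - (\rank A + 2 <= n)%N%:R :> Z.
Proof.
move=> symA; have rA := rank_leq_row A.
have -> : ~~ row_free (row_mx A b^T) = (\rank A + ~~ (b <= A)%MS < n)%N.
  by rewrite -rank_row_mx_tr symA ltn_neqAle rank_leq_row andbT.
have [/submxP[w ->]|bA] := boolP (b <= A)%MS; last first.
  under eq_bigr do rewrite rank_bordered_out //.
  by rewrite sum_const_field /= -addnS subrr.
rewrite addn0; set c := (w *m A *m w^T) 0 0.
under eq_bigr => t _ do rewrite rank_bordered_in // -/c -[c](subrKC s) (inj_eq (addrI s)).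
move: (\rank A) (c - s) rA => r d; case: ltngtP => // [ltrn|->] _; last first.
  rewrite big1 ?addn2 ?[(_.+2 <= _)%N]ltnNge ?leqnSn ?subrr // => t _.
  by rewrite addn2 ltnS ltnNge leq_addl.
have [<-|ne_rn] := eqVneq r.+1 n.
  rewrite addn2 ltnn subr0 -[RHS](sum_pred1_field d).
  apply: eq_bigr => t _; rewrite addn2 !ltnS.
  by case: (t == d); rewrite ?leqnn // add1n ltnn.
have {ne_rn ltrn} ltrn : (r.+1 < n)%N by rewrite ltn_neqAle ne_rn.
rewrite addn2 ltrn subrr -[RHS](sum_const_field 1).
apply: eq_bigr => t _; rewrite addn2 ltnS (leq_trans _ ltrn) //.
by rewrite ltnS -add1n leq_add2r leq_b1.
Qed.

Lemma sum_ffun_forall m (g : 'I_m -> F -> bool) :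
  \sum_(x : {ffun 'I_m -> F}) [forall i, g i (x i)]%:R
  = \prod_i \sum_(t : F) (g i t)%:R :> Z.
Proof.
rewrite bigA_distr_bigA; apply: eq_bigr => x _.
case: (boolP [forall i, _]) => [/forallP gx|/forallPn[i /negPf gx]].
  by rewrite big1 // => i _; rewrite gx.
by rewrite (bigD1 i) //= gx mul0r.
Qed.

Lemma sum_affine (c k : F) :
  \sum_(t : F) (c + k * t == 0)%:R = (k != 0)%:R :> Z.
Proof.
have [->|nz_k] := eqVneq k 0.
  by under eq_bigr do rewrite mul0r; rewrite sum_const_field.
rewrite -[RHS](sum_pred1_field (- c / k)); apply: eq_bigr => t _.
by rewrite addrC addr_eq0 -[t == _](inj_eq (mulfI nz_k)) mulrCA divff // mulr1.
Qed.

(** The solutions form an affine space which is empty or of dimension at least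
    w - 1 > 0. *)
Lemma sum_affine_row w (y : 'cV[F]_w) c : (2 <= w)%N ->
  \sum_(z : 'rV_w) (c + z *m y == 0)%:R = 0 :> Z.
Proof.
move=> w2; have [z0 /eqP z0P|no_sol] := pickP (fun z : 'rV_w => c + z *m y == 0);
  last first.
  by rewrite big1 // => z _; rewrite no_sol.
have free_y : row_free y = false.
  by apply: contraTF w2 => /eqP <-; rewrite -ltnNge ltnS rank_leq_col.
rewrite -[RHS]/(false%:R) -free_y -sum_kernel (reindex_inj (addrI z0)) /=.
apply: eq_bigr => z _.
by rewrite mulmxDl addrA z0P add0r.
Qed.

Lemma sum_row_mx m w (f : 'rV[F]_(m + w) -> Z) :
  \sum_z f z = \sum_(k : 'rV_m) \sum_(p : 'rV_w) f (row_mx k p).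
Proof.
rewrite pair_big /= (reindex (fun kp : 'rV_m * 'rV_w => row_mx kp.1 kp.2)) //=.
apply: onW_bij; exists (fun z => (lsubmx z, rsubmx z)) => [[k p]|z] /=.
  by rewrite row_mxKl row_mxKr.
exact: hsubmxK.
Qed.

Lemma kernel_partial_diag m w (S : 'M[F]_(m + w)) (b : 'cV_(m + w))
    (k : 'rV_m) (p : 'rV_w) (x : {ffun 'I_m -> F}) :
  drsubmx S = 0 ->
  (row_mx k p *m row_mx (S + partial_diag w x) b == 0)
  = [forall i, (k *m ulsubmx S + p *m dlsubmx S) 0 i + k 0 i * x i == 0]
    && (k *m ursubmx S == 0) && (k *m usubmx b + p *m dsubmx b == 0).
Proof.
move=> S0; rewrite mul_mx_row row_mx_eq0; congr (_ && _); last first.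
  by rewrite -[b in LHS]vsubmxK mul_row_col.
rewrite -[S in LHS]submxK S0 /partial_diag diag_mx_row raddf0.
rewrite add_block_mx !addr0 mul_row_block row_mx_eq0.
rewrite mulmx0 addr0; congr (_ && _); rewrite mulmxDr addrAC.
apply/eqP/forallP => [/rowP E i|E].
  by have := E i; rewrite mul_mx_diag !mxE => ->.
by apply/rowP => i; rewrite mul_mx_diag !mxE; apply/eqP; have := E i; rewrite !mxE.
Qed.

(** The complement is counted through pairs (x, z) with z in the left kernel:
    by [sum_kernel] this counts the x for which that kernel is trivial.  Summing
    over x first leaves only the vectors z = (k, p) without zero entry in k and
    with k *m ursubmx S = 0; as drsubmx S = 0, the only equation left on p is the
    one given by b, and it has a multiple of q solutions. *)
Lemma sum_bordered_not_free m w (S : 'M[F]_(m + w)) (b : 'cV_(m + w)) :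
  (2 <= w)%N -> drsubmx S = 0 ->
  \sum_(x : {ffun 'I_m -> F}) (~~ row_free (row_mx (S + partial_diag w x) b))%:R
  = (m == 0)%N%:R :> Z.
Proof.
move=> w2 S0.
have negb_nat (c : bool) : (~~ c)%:R = 1 - c%:R :> Z by case: c; rewrite ?subrr ?subr0.
under eq_bigr => x _ do rewrite negb_nat -sum_kernel.
rewrite big_split /= sumr_const cardT -cardE card_ffun card_ord natrX q_eq0 expr0n.
rewrite -[RHS]addr0; congr (_ + _).
rewrite sumrN exchange_big sum_row_mx big1 ?oppr0 // => k _.
transitivity ((k *m ursubmx S == 0)%:R * (\prod_i (k 0 i != 0)%:R) *
   \sum_(p : 'rV_w) (k *m usubmx b + p *m dsubmx b == 0)%:R : Z); last first.
  by rewrite sum_affine_row // mulr0.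
rewrite mulr_sumr; apply: eq_bigr => p _.
under eq_bigr => x _ do rewrite kernel_partial_diag // -!mulnb !natrM.
pose c := k *m ulsubmx S + p *m dlsubmx S.
rewrite -!mulr_suml (sum_ffun_forall (fun i t => c 0 i + k 0 i * t == 0)).
congr (_ * _); rewrite mulrC; congr (_ * _).
by apply: eq_bigr => i _; rewrite sum_affine.
Qed.

Definition cons_ffun m (t : F) (x : {ffun 'I_m -> F}) : {ffun 'I_m.+1 -> F} :=
  [ffun i => oapp x t (unlift ord0 i)].

Lemma sum_cons_ffun m (f : {ffun 'I_m.+1 -> F} -> Z) :
  \sum_x f x = \sum_(x : {ffun 'I_m -> F}) \sum_(t : F) f (cons_ffun t x).
Proof.
rewrite pair_big /= (reindex (fun xt => cons_ffun xt.2 xt.1)) //=.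
apply: onW_bij.
exists (fun x : {ffun 'I_m.+1 -> F} => ([ffun i => x (lift ord0 i)], x ord0))
  => [[x t]|x] /=.
  congr (_, _); last by rewrite ffunE unlift_none.
  by apply/ffunP => i; rewrite !ffunE liftK.
by apply/ffunP => i; rewrite ffunE; case: unliftP => [j|] ->; rewrite /= ?ffunE.
Qed.

Lemma partial_diag_cons m w t (x : {ffun 'I_m -> F}) :
  partial_diag w (cons_ffun t x)
  = block_mx t%:M 0 0 (partial_diag w x) :> 'M_(1 + (m + w)).
Proof.
have -> : block_mx t%:M 0 0 (partial_diag w x)
          = diag_mx (row_mx (const_mx t : 'rV_1) (row_mx (\row_i x i) 0)).
  by rewrite [RHS]diag_mx_row diag_const_mx.
rewrite row_mxA castmx_id /partial_diag.
apply: (congr1 (fun r : 'rV_(1 + m) => diag_mx (row_mx r 0))).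
apply/rowP => i; rewrite !mxE ffunE; case: split_ordP => j ->; rewrite !mxE.
  rewrite [lshift _ _](_ : _ = ord0) ?unlift_none //.
  by apply: val_inj; rewrite /= [j]ord1.
by rewrite [rshift _ _](_ : _ = lift ord0 j) ?liftK //; apply: val_inj.
Qed.

(** Induction on the number of variables: the fiber formula reduces the sum to
    the difference of [sum_bordered_not_free] and of the induction hypothesis,
    which both are (m == 0). For m = 0 the matrix is zero of size w >= 2. *)
Lemma sum_corank_ge2 m w (S : 'M[F]_(m + w)) :
  (2 <= w)%N -> S^T = S -> drsubmx S = 0 ->
  \sum_(x : {ffun 'I_m -> F}) (\rank (S + partial_diag w x)%R + 2 <= m + w)%N%:R
  = (m == 0)%N%:R :> Z.
Proof.
move=> w2; elim: m S => [|m IHm] S symS S0.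
  rewrite (eq_bigr (fun=> 1)) => [|x _].
    by rewrite sumr_const cardT -cardE card_ffun card_ord expn0.
  have [-> ->] : S = 0 /\ partial_diag w x = 0; last by rewrite addr0 mxrank0 w2.
  split; last by rewrite /partial_diag [\row_i x i]thinmx0 row_mx0 raddf0.
  rewrite -[S]submxK S0 [ulsubmx S]flatmx0 [ursubmx S]flatmx0 [dlsubmx S]thinmx0.
  by rewrite block_mx0.
pose S1 : 'M_(1 + (m + w)) := S; pose A := drsubmx S1; pose b := ursubmx S1.
have symA : A^T = A by rewrite /A trmx_drsub [S1^T]symS.
have A0 : drsubmx A = 0.
  apply/matrixP => i j; have /matrixP/(_ i j) := S0; rewrite !mxE => <-.
  by congr (S _ _); apply: val_inj.
have symAx x : (A + partial_diag w x)^T = A + partial_diag w x.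
  by rewrite raddfD /= symA tr_diag_mx.
have bordered t x : S + partial_diag w (cons_ffun t x)
    = block_mx (S1 0 0 + t)%:M b b^T (A + partial_diag w x) :> 'M_(1 + (m + w)).
  rewrite partial_diag_cons -[LHS]/(S1 + block_mx t%:M 0 0 (partial_diag w x)).
  rewrite -[S1 in LHS]submxK add_block_mx !addr0.
  congr block_mx; last by rewrite /b trmx_ursub [S1^T]symS.
  rewrite raddfD /=; congr (_ + _); rewrite [LHS]mx11_scalar !mxE; congr (S1 _ _)%:M.
    by apply: val_inj.
  by apply: val_inj.
rewrite sum_cons_ffun.
under eq_bigr => x _ do under eq_bigr => t _ do rewrite bordered.
under eq_bigr => x _ do rewrite sum_corank_ge2_fiber //.
by rewrite sumrB sum_bordered_not_free // IHm // subrr.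
Qed.

End CountModQ.

(** * Determinants with a variable diagonal block *)

Section DetExpansion.
Variables (R : comNzRingType) (m w : nat).

Definition sel_mx (T : {set 'I_m}) : 'M[R]_m := diag_mx (\row_e (e \in T)%:R).

(** Distribute the product over the first m rows in the Leibniz formula: each
    such row contributes either its variable, times a unit row, or its part in
    A. *)
Lemma det_diag_expansion (x : 'I_m -> R) (A : 'M[R]_(m, w)) C U :
  \det (block_mx (diag_mx (\row_e x e)) A C U)
  = \sum_(T : {set 'I_m}) (\prod_(e | e \notin T) x e) *
      \det (block_mx (sel_mx (~: T)) (sel_mx T *m A) C U).
Proof.
pose sel_row (T : {set 'I_m}) e : 'rV[R]_(m + w) :=
  if e \in T then row_mx 0 (row e A) else delta_mx 0 (lshift w e).
have selE (T : {set 'I_m}) e j :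
    block_mx (sel_mx (~: T)) (sel_mx T *m A) C U (lshift w e) j = sel_row T e 0 j.
  rewrite /sel_row /sel_mx; case: (split_ordP j) => k ->.
    rewrite block_mxEul !mxE inE; case: (e \in T); first by rewrite row_mxEl mxE mul0rn.
    by rewrite mxE eqxx (inj_eq (@lshift_inj _ _)) [k == e]eq_sym.
  rewrite block_mxEur mul_diag_mx !mxE; case: (e \in T); rewrite ?row_mxEr ?mxE ?mul1r //.
  by rewrite eq_rlshift mul0r.
have entryE (e : 'I_m) j : block_mx (diag_mx (\row_e x e)) A C U (lshift w e) j
    = row_mx 0 (row e A) 0 j + x e * (delta_mx 0 (lshift w e) : 'rV_(m + w)) 0 j.
  case: (split_ordP j) => k ->.
    rewrite block_mxEul row_mxEl !mxE eqxx (inj_eq (@lshift_inj _ _)).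
    by rewrite add0r mulr_natr eq_sym.
  by rewrite block_mxEur row_mxEr !mxE eq_rlshift mulr0 addr0.
rewrite /determinant.
under [RHS]eq_bigr do rewrite mulr_sumr.
rewrite exchange_big; apply: eq_bigr => s _ /=.
rewrite big_split_ord /= (eq_bigr _ (fun e _ => entryE e (s (lshift w e)))) bigA_distr.
rewrite mulr_suml mulr_sumr; apply: eq_bigr => T _.
rewrite [in RHS]big_split_ord /= [RHS]mulrCA; congr (_ * _).
rewrite mulrA; congr (_ * _); last first.
  apply: eq_bigr => j _; case: (split_ordP (s (rshift m j))) => k ->;
    by rewrite ?block_mxEdl ?block_mxEdr.
rewrite [X in _ = X * _]big_mkcond -big_split /=; apply: eq_bigr => e _.
by rewrite selE /sel_row; case: (e \in T); rewrite ?mul1r.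
Qed.

Lemma tr_sel_mx T : (sel_mx T)^T = sel_mx T.
Proof. exact: tr_diag_mx. Qed.

Lemma sel_mxM T T' : sel_mx T *m sel_mx T' = sel_mx (T :&: T').
Proof.
rewrite mulmx_diag; congr diag_mx; apply/rowP => e.
by rewrite !mxE inE -natrM mulnb.
Qed.

Lemma sel_mxC T : sel_mx (~: T) = 1%:M - sel_mx T.
Proof.
rewrite -diag_const_mx -raddfB; congr diag_mx; apply/rowP => e.
by rewrite !mxE inE; case: (e \in T); rewrite ?subrr ?subr0.
Qed.

Lemma sel_mx0 : sel_mx set0 = 0.
Proof. by apply/matrixP => i j; rewrite !mxE inE mul0rn. Qed.

(** The unit rows also clear the entries of B below them. *)
Lemma det_sel_sym T (B : 'M[R]_(w, m)) (U := B *m sel_mx T) :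
  \det (block_mx (sel_mx (~: T)) (sel_mx T *m B^T) B 0)
  = \det (block_mx (sel_mx (~: T)) U^T U 0).
Proof.
have -> : block_mx (sel_mx (~: T)) (sel_mx T *m B^T) B 0
   = block_mx 1%:M 0 (B *m sel_mx (~: T)) 1%:M *m block_mx (sel_mx (~: T)) U^T U 0.
  rewrite mulmx_block !mul1mx !mul0mx !addr0 trmx_mul tr_sel_mx.
  rewrite -!mulmxA [sel_mx _ *m (sel_mx T *m _)]mulmxA !sel_mxM setIid.
  by rewrite [_ :&: T]setIC setICr sel_mx0 mul0mx mulmx0 -mulmxDr sel_mxC subrK mulmx1.
by rewrite det_mulmx det_lblock !det1 !mul1r.
Qed.

(** Adding P times the lower rows to the upper ones turns D into the identity,
    which is then used as a pivot. *)
Lemma det_block_gram (D : 'M[R]_m) (P : 'M_(m, w)) (U : 'M_(w, m)) :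
  D + P *m U = 1%:M ->
  \det (block_mx D U^T U 0) = (-1) ^+ w * \det (U *m U^T).
Proof.
move=> DPU.
have <- : \det (block_mx 1%:M P 0 1%:M *m block_mx D U^T U 0) = \det (block_mx D U^T U 0).
  by rewrite det_mulmx det_ublock !det1 !mul1r.
rewrite mulmx_block !mul1mx !mul0mx !mulmx0 !addr0 !add0r DPU.
have <- : \det (block_mx 1%:M 0 (- U) 1%:M *m block_mx 1%:M U^T U 0)
          = \det (block_mx 1%:M U^T U 0).
  by rewrite det_mulmx det_lblock !det1 !mul1r.
rewrite mulmx_block !mul1mx !mul0mx !mulmx1 !addr0 addNr mulNmx.
by rewrite det_ublock det1 mul1r -scaleN1r detZ.
Qed.

End DetExpansion.

(** The hypotheses make P a two-sided inverse of the columns of B in T.  Taking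
    traces gives #|T| = w, so these columns form a square integer matrix; its
    determinant is a unit, hence squares to 1.  The square removes the dependence
    on the ordering and orientation of the edges, and the remaining sign depends
    only on w. *)
Lemma det_sel_unimodular m w (T : {set 'I_m}) (B : 'M[int]_(w, m))
    (P Phi : 'M[int]_(m, w)) :
  sel_mx int T *m P = P -> B *m P = 1%:M ->
  Phi *m (B *m sel_mx int T) = sel_mx int T ->
  \det (block_mx (sel_mx int (~: T)) (B *m sel_mx int T)^T (B *m sel_mx int T) 0)
  = (-1) ^+ w.
Proof.
set E := sel_mx int T; set U := B *m E => EP BP PhiU.
have UP : U *m P = 1%:M by rewrite -mulmxA EP.
have PhiP : Phi = P by rewrite -[LHS]mulmx1 -UP mulmxA PhiU EP.
have PU : P *m U = E by rewrite -PhiU PhiP.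
have cardT : #|T| = w.
  have := mxtrace_mulC U P; rewrite UP PU mxtrace1 mxtrace_diag.
  under eq_bigr do rewrite mxE.
  by rewrite -natr_sum -big_mkcond sum1_card => /eqP; rewrite Num.Theory.eqr_nat => /eqP.
have detUU : \det (U *m U^T) = 1.
  pose f i := enum_val (cast_ord (esym cardT) i).
  have sumf (g : 'I_m -> int) : \sum_(e in T) g e = \sum_i g (f i).
    rewrite big_enum_val /= (reindex (cast_ord (esym cardT))) //.
    by apply: onW_bij; exists (cast_ord cardT); [exact: cast_ordKV | exact: cast_ordK].
  have sel_sum p q (X : 'M_(p, m)) (Y : 'M_(m, q)) :
      X *m E *m Y = colsub f X *m rowsub f Y.
    apply/matrixP => i j; rewrite mul_mx_diag !mxE.
    under [RHS]eq_bigr do rewrite !mxE.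
    rewrite -(sumf (fun e => X i e * Y e j)) [RHS]big_mkcond; apply: eq_bigr => e _.
    by rewrite !mxE; case: (e \in T); rewrite ?mulr1 ?mulr0 ?mul0r.
  have -> : U *m U^T = colsub f B *m (colsub f B)^T.
    rewrite trmx_mul tr_sel_mx mulmxA -[U *m _]mulmxA sel_mxM setIid sel_sum.
    by congr (_ *m _); apply/matrixP => i j; rewrite !mxE.
  have unitC : \det (colsub f B) * \det (rowsub f P) = 1.
    by rewrite -det_mulmx -sel_sum UP det1.
  rewrite det_mulmx det_tr.
  have : \det (colsub f B) \is a GRing.unit by apply/unitrPr; eexists; apply: unitC.
  by move=> /orP[] /eqP->; rewrite ?mulrNN mulr1.
by rewrite (@det_block_gram _ _ _ _ P) ?detUU ?mulr1 // PU sel_mxC subrK.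
Qed.

(** * Connectivity, cuts and cycles *)

Section GraphIncidence.
Variable G : multigraph.
Local Notation V := (vertex G).
Local Notation E := 'I_(num_edges G).
Implicit Types (T : {set E}) (e f : E) (u v : V).

Definition adj T : rel V := [rel u v | [exists e in T, joins e u v]].

Lemma joinsC e u v : joins e u v = joins e v u.
Proof. exact: orbC. Qed.

Lemma joins_ends e : joins e (ends e).1 (ends e).2.
Proof. by rewrite /joins -surjective_pairing eqxx. Qed.

Lemma adj_sym T : ssrbool.symmetric (adj T).
Proof. by move=> u v; apply: eq_existsb => e; rewrite joinsC. Qed.

Lemma joins_inv e u v : joins e u v ->
  (ends e).1 = u /\ (ends e).2 = v \/ (ends e).1 = v /\ (ends e).2 = u.
Proof. by case/orP => /eqP->; [left | right]. Qed.

Lemma potential_connect (A : eqType) T (p : V -> A) u v :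
  (forall e, e \in T -> p (ends e).1 = p (ends e).2) ->
  connect (adj T) u v -> p u = p v.
Proof.
move=> pT cuv.
have clT : closed (adj T) [pred x | p x == p v].
  move=> x y /existsP[e /andP[eT /joins_inv exy]]; rewrite !inE.
  by case: exy (pT e eT) => [] [-> ->] ->.
by have := closed_connect clT cuv; rewrite !inE eqxx => /eqP.
Qed.

(** A simple path in T :\ e between the ends of e would be closed by e into a
    cycle in T. *)
Lemma acyclic_cut T e : acyclic T -> e \in T ->
  ~~ connect (adj (T :\ e)) (ends e).1 (ends e).2.
Proof.
move=> /acyclicP acT eT; apply/negP => /connectP[p0].
move=> /shortenP[p pathp uniqp _ {p0}] lastp.
set a := (ends e).1 in pathp uniqp lastp.
pose v i := nth a (a :: p) i.
pose g i := odflt e [pick f in T :\ e | joins f (v i) (v i.+1)].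
have gP i : (i < size p)%N -> g i \in T :\ e /\ joins (g i) (v i) (v i.+1).
  move=> ip; rewrite /g; case: pickP => [f /andP[]//|no].
  have /existsP[f /andP[fT fj]] := pathP a pathp i ip.
  by have := no f; rewrite /= fT fj.
have v_inj i j : (i <= size p)%N -> (j <= size p)%N -> v i = v j -> i = j.
  by move=> ip jp /eqP; rewrite nth_uniq // => /eqP.
have g_inj i j : (i < size p)%N -> (j < size p)%N -> g i = g j -> i = j.
  move=> ip jp gij.
  have : v i = v j \/ v i = v j.+1 /\ v i.+1 = v j.
    have [_ /joins_inv] := gP j jp; have [_ /joins_inv] := gP i ip; rewrite gij.
    by case=> [] [-> ->] [] [-> ->]; auto.
  case=> [|[/v_inj eij /v_inj eSi]]; first by apply: v_inj; apply: ltnW.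
  have := eSi ip (ltnW jp); rewrite (eij (ltnW ip) jp) => /eqP.
  by rewrite -[j.+2]addn2 -[X in _ == X]addn0 eqn_add2l.
pose n := size p.
pose cv := [ffun i : 'I_n.+1 => v i].
pose ce := [ffun i : 'I_n.+1 => if (i < n)%N then g i else e].
have le_n (i : 'I_n.+1) : (i <= n)%N by rewrite -ltnS.
have [] := acT n cv ce.
  apply/and3P; split.
  - by apply/injectiveP => i j; rewrite !ffunE => /v_inj ij; apply/val_inj/ij.
  - apply/injectiveP => i j; rewrite !ffunE.
    case: ltnP => [i_n|n_i]; case: ltnP => [jn|nj] eqe.
    + exact/val_inj/g_inj.
    + by have [] := gP i i_n; rewrite eqe !inE eqxx.
    + by have [] := gP j jn; rewrite -eqe !inE eqxx.
    + apply/val_inj/eqP; rewrite eqn_leq (leq_trans (le_n i) nj).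
      exact: leq_trans (le_n j) n_i.
  - apply/forallP => i; rewrite !ffunE /=; case: ltnP => [i_n|n_i].
      by rewrite modn_small ?ltnS //; case: (gP i i_n).
    have -> : i = n :> nat by apply/eqP; rewrite eqn_leq le_n.
    have -> : v n = (ends e).2 by rewrite /v -[n]/(size (a :: p)).-1 nth_last lastp.
    by rewrite modnn joinsC joins_ends.
move=> i; rewrite ffunE; case: ltnP => [i_n|_]; last by rewrite eT.
by have [] := gP i i_n; rewrite inE => /andP[_ ->].
Qed.

(** * The incidence matrix with the root removed *)

Variable r : V.
Local Notation W := #|predC1 r|.

Definition vtx (i : 'I_W) : V := enum_val i.

Lemma vtx_neq_root i : vtx i != r.
Proof. by have := enum_valP i; rewrite !inE. Qed.

Section IncidenceMatrix.
Variable R : nzRingType.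

(** The class of the vertex u in the free module on the vertices modulo the
    root; it vanishes for the root itself. *)
Definition vertex_col u : 'cV[R]_W := \col_i (u == vtx i)%:R.

Definition incidence : 'M[R]_(W, num_edges G) :=
  \matrix_(i, e) (((ends e).1 == vtx i)%:R - ((ends e).2 == vtx i)%:R).

Lemma col_incidence e :
  col e incidence = vertex_col (ends e).1 - vertex_col (ends e).2.
Proof. by apply/colP => i; rewrite !mxE. Qed.

Lemma vertex_col_root : vertex_col r = 0.
Proof. by apply/colP => i; rewrite !mxE eq_sym (negPf (vtx_neq_root i)). Qed.

Lemma potential_vertex_col (p : V -> R) u : p r = 0 ->
  (\row_i p (vtx i) *m vertex_col u) 0 0 = p u.
Proof.
move=> pr; have [->|u_r] := eqVneq u r; first by rewrite vertex_col_root mulmx0 mxE pr.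
have uW : u \in predC1 r by [].
rewrite !mxE (bigD1 (enum_rank_in uW u)) //= !mxE /vtx enum_rankK_in // eqxx mulr1.
rewrite big1 ?addr0 // => i i_u; rewrite !mxE.
case: eqVneq => [eq_u|]; last by rewrite mulr0.
by case/eqP: i_u; apply: enum_val_inj; rewrite enum_rankK_in.
Qed.

Lemma potential_incidence (p : V -> R) e : p r = 0 ->
  (\row_i p (vtx i) *m incidence) 0 e = p (ends e).1 - p (ends e).2.
Proof.
move=> pr; have -> (M : 'rV[R]_(num_edges G)) : M 0 e = (col e M) 0 0 by rewrite mxE.
rewrite colE -mulmxA -colE col_incidence mulmxBr mxE.
by rewrite [X in _ + X]mxE !potential_vertex_col.
Qed.

(** The function on vertices with values z off the root and 0 at the root. *)
Definition row_potential (z : 'rV[R]_W) u : R := (z *m vertex_col u) 0 0.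

Lemma row_potential_root z : row_potential z r = 0.
Proof. by rewrite /row_potential vertex_col_root mulmx0 mxE. Qed.

Lemma row_potentialK z : \row_i row_potential z (vtx i) = z.
Proof.
apply/rowP => i; rewrite mxE /row_potential mxE (bigD1 i) //=.
rewrite !mxE eqxx mulr1 big1 ?addr0 // => j ji.
by rewrite !mxE (inj_eq enum_val_inj) eq_sym (negPf ji) mulr0.
Qed.

Lemma connected_incidence_inj T (z : 'rV[R]_W) : connected_by T ->
  (forall e, e \in T -> (z *m incidence) 0 e = 0) -> z = 0.
Proof.
move=> /forallP connT zB; rewrite -(row_potentialK z).
apply/rowP => i; rewrite !mxE -[RHS](row_potential_root z).
apply: (@potential_connect _ T); last exact: (forallP (connT _) r).
move=> e /zB; rewrite -{1}(row_potentialK z) potential_incidence ?row_potential_root //.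
exact: subr0_eq.
Qed.

End IncidenceMatrix.

(** The indicator of the vertices that are not connected to the root. *)
Lemma disconnected_potential T : ~~ connected_by T ->
  exists2 z : 'rV[int]_W, z != 0 & z *m (incidence int *m sel_mx int T) = 0.
Proof.
move=> disc; have [u nconn] : exists u, ~~ connect (adj T) r u.
  apply/existsP; rewrite -negb_forall; apply: contra disc => /forallP conn.
  apply/forallP => u; apply/forallP => v; apply: connect_trans (conn v).
  by rewrite (sym_connect_sym (@adj_sym T)).
pose p v : int := (~~ connect (adj T) r v)%:R.
have pr : p r = 0 by rewrite /p connect0.
exists (\row_i p (vtx i)).
  apply: contraNneq nconn => p0; have := potential_vertex_col u pr.
  by rewrite p0 mul0mx mxE /p; case: connect.
apply/rowP => e; rewrite mulmxA mul_mx_diag mxE potential_incidence // !mxE.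
have [eT|] := boolP (e \in T); last by rewrite mulr0.
rewrite /p (same_connect_r (sym_connect_sym (@adj_sym T)) (_ : connect _ _ (ends e).2)).
  by rewrite subrr mul0r.
by apply/connect1/existsP; exists e; rewrite eT joins_ends.
Qed.

(** For e in T, the component of an end of e in T :\ e is a cut that meets T in
    e only; the corresponding potential gives row e of the matrix. *)
Lemma acyclic_cut_matrix T : acyclic T ->
  exists Phi : 'M[int]_(num_edges G, W),
    Phi *m (incidence int *m sel_mx int T) = sel_mx int T.
Proof.
move=> acT.
have cut e : exists z : 'rV[int]_W, e \in T ->
    z *m (incidence int *m sel_mx int T) = delta_mx 0 e.
  have [eT|_] := boolP (e \in T); last by exists 0.
  pose c v := connect (adj (T :\ e)) (ends e).1 v.
  pose p v : int := (c v)%:R - (c r)%:R.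
  exists (\row_i p (vtx i)) => _; apply/rowP => f.
  rewrite mulmxA mul_mx_diag mxE potential_incidence /p ?subrr // !mxE eqxx /=.
  rewrite opprB addrA subrK.
  have [->|f_e] := eqVneq f e; first
    by rewrite /c connect0 (negPf (acyclic_cut acT eT)) subr0 eT mulr1.
  have [fT|] := boolP (f \in T); last by rewrite mulr0.
  rewrite /c (same_connect_r (sym_connect_sym (@adj_sym _)) (_ : connect _ _ (ends f).2)).
    by rewrite subrr mul0r.
  by apply/connect1/existsP; exists f; rewrite !inE f_e fT joins_ends.
have [z zP] := fin_all_exists cut.
exists (\matrix_e if e \in T then z e else 0); apply/row_matrixP => e.
rewrite row_mul rowK; have [eT|eT] := boolP (e \in T).
  by rewrite zP //; apply/rowP => f; rewrite !mxE eT eqxx [e == f]eq_sym; case: (f == e).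
by rewrite mul0mx; apply/rowP => f; rewrite !mxE (negPf eT) mul0rn.
Qed.

(** Column i is the signed sum of the edges of a path in T between the vertex i
    and the root. *)
Lemma connected_path_matrix T : connected_by T ->
  exists2 P : 'M[int]_(num_edges G, W),
    sel_mx int T *m P = P & incidence int *m P = 1%:M.
Proof.
move=> /forallP connT; pose B := incidence int; pose S := sel_mx int T.
pose flow_to u :=
  exists2 p : 'cV[int]_(num_edges G), S *m p = p & B *m p = vertex_col int u.
have flow_root : flow_to r by exists 0; rewrite mulmx0 ?vertex_col_root.
have flow_edge u v : adj T u v -> flow_to u -> flow_to v.
  case/existsP => e /andP[eT euv] [p Sp Bp].
  have Se : S *m delta_mx e 0 = delta_mx e 0 :> 'cV_ _.
    apply/colP => f; rewrite mul_diag_mx !mxE.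
    by case: (eqVneq f e) => [->|]; rewrite ?eT ?mul1r ?mulr0.
  have Be : B *m delta_mx e 0 = vertex_col int (ends e).1 - vertex_col int (ends e).2.
    by rewrite -colE col_incidence.
  case: (joins_inv euv) Be => -[-> ->] Be.
    by exists (p - delta_mx e 0); rewrite mulmxBr ?Sp ?Se // Bp Be opprB addrC subrK.
  by exists (p + delta_mx e 0); rewrite mulmxDr ?Sp ?Se // Bp Be addrC subrK.
have flow u : flow_to u.
  have /connectP[p pathp ->] := forallP (connT r) u.
  elim: p (r) pathp flow_root => //= v p IHp w /andP[wv pathp] fw.
  exact: IHp pathp (flow_edge _ _ wv fw).
have flow1 i : exists p : 'cV[int]_(num_edges G),
    S *m p = p /\ B *m p = vertex_col int (vtx i).
  by have [p Sp Bp] := flow (vtx i); exists p.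
have [p pP] := fin_all_exists flow1.
pose P := \matrix_(e, i) p i e 0.
have colP' i : col i P = p i by apply/colP => e; rewrite !mxE.
have mulP n (M : 'M[int]_(n, _)) j i : (M *m P) j i = (M *m p i) j 0.
  by rewrite -[in RHS]colP' colE mulmxA -colE [RHS]mxE.
exists P; apply/matrixP => j i; rewrite mulP; first by rewrite (pP i).1 mxE.
by rewrite (pP i).2 !mxE (inj_eq enum_val_inj) eq_sym.
Qed.

(** The signed sum of the edges of a cycle in T. *)
Lemma cyclic_flow T : ~~ acyclic T ->
  exists z : 'rV[int]_(num_edges G),
    [/\ z != 0, z *m sel_mx int T = z & z *m (incidence int)^T = 0].
Proof.
case/forallPn => k /forallPn[v /forallPn[e]]; rewrite negb_imply negbK.
case/andP => /and3P[_ /injectiveP e_inj /forallP e_joins] /forallP eT.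
pose sgn i : int := if ends (e i) == (v i, v (ordS i)) then 1 else -1.
exists (\sum_i sgn i *: delta_mx 0 (e i)); split.
- apply/eqP => /rowP/(_ (e ord0)); rewrite summxE (bigD1 ord0) //= !mxE !eqxx.
  rewrite big1 ?addr0 => [|i i0].
    by rewrite /sgn; case: ifP.
  by rewrite !mxE (inj_eq e_inj) eq_sym (negPf i0) mulr0.
- rewrite mulmx_suml; apply: eq_bigr => i _; rewrite -scalemxAl; congr (_ *: _).
  apply/rowP => f; rewrite mul_mx_diag !mxE eqxx /=.
  by case: (eqVneq f (e i)) => [->|]; rewrite ?eT ?mul0r.
- rewrite mulmx_suml.
  under eq_bigr => i _.
    rewrite -scalemxAl -rowE -tr_col col_incidence.
    rewrite (_ : _ *: _ = (vertex_col int (v i))^T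
                          - (vertex_col int (v (ordS i)))^T); last first.
      rewrite /sgn; case: eqP => [->|ne]; first by rewrite scale1r raddfB.
      have := e_joins i; rewrite /joins; case: eqP => // _ /eqP-> /=.
      by rewrite scaleN1r raddfB opprB.
    over.
  by rewrite sumrB (reindex_inj (@ordS_inj _)) subrr.
Qed.

End GraphIncidence.

(** * Corank at least two of a symmetric matrix *)

(** If the kernel of M is spanned by a single z and y is in the kernel of
    M + delta_mx i i, then pairing with z gives y_i z_i = 0.  If z_i != 0 this
    puts y in the kernel of M, hence on the line of z, with y_i = 0, so y = 0.
    Thus z_i = 0 for all i in I, against the hypothesis on I. *)
Lemma corank_ge2E (K : fieldType) n (M : 'M[K]_n) (I : {set 'I_n}) :
  M^T = M ->
  (forall z : 'rV_n, z *m M = 0 -> (forall i, i \in I -> z 0 i = 0) -> z = 0) ->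
  (\rank M + 2 <= n)%N
  = (\det M == 0) && [forall i in I, \det (M + delta_mx i i) == 0].
Proof.
move=> symM kerI.
have det_rank (A : 'M[K]_n) : (\det A == 0) = (\rank A < n)%N.
  rewrite ltn_neqAle rank_leq_row andbT -[_ == n]/(row_free A) row_free_unit unitmxE.
  by rewrite unitfE negbK.
apply/idP/andP => [rkM|[detM /forall_inP detMi]].
  rewrite det_rank (leq_trans _ rkM) ?addn2 //; split=> //.
  apply/forall_inP => i _; rewrite det_rank (leq_ltn_trans (mxrank_add _ _)) //.
  by rewrite mxrank_delta addn1 -addn2.
rewrite leqNgt addn2 ltnS; apply/negP => rkM.
have {}rkM : \rank M = n.-1.
  move: detM; rewrite det_rank; case: (n) (\rank M) rkM => [|k] l //=.
  by rewrite !ltnS => k_l l_k; apply/eqP; rewrite eqn_leq l_k.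
have [z nz_z zM] := det0P detM.
case/eqP: (nz_z); apply: kerI => // i iI; apply/eqP; apply: contraT => zi.
have [y nz_y yMi] := det0P (detMi i iI).
have yi : y 0 i = 0.
  have : y *m (M + delta_mx i i) *m z^T = 0 by rewrite yMi mul0mx.
  rewrite mulmxDr mulmxDl -[y *m M *m _]mulmxA -[M *m _]trmxK trmx_mul trmxK symM zM.
  rewrite trmx0 mulmx0 add0r => /matrixP/(_ 0 0).
  rewrite -(mul_delta_mx (0 : 'I_1) i i) !mulmxA -colE -mulmxA -rowE.
  by rewrite mxE big_ord1 !mxE => /eqP; rewrite mulf_eq0 (negPf zi) orbF => /eqP.
have yM : y *m M = 0.
  move: yMi; rewrite mulmxDr -(mul_delta_mx (0 : 'I_1) i i) mulmxA -colE.
  by rewrite (_ : col i y = 0) ?mul0mx ?addr0 //; apply/colP => j; rewrite !mxE !ord1.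
have ker_z : (kermx M <= z)%MS.
  have zker : (z <= kermx M)%MS by apply/sub_kermxP.
  rewrite -(geq_leqif (mxrank_leqif_sup zker)) mxrank_ker rkM rank_rV nz_z.
  by case: (n) => // k; rewrite subSnn.
have /sub_rVP[c y_cz] : (y <= z)%MS by apply: submx_trans ker_z; apply/sub_kermxP.
move: yi; rewrite y_cz mxE => /eqP; rewrite mulf_eq0 (negPf zi) orbF => /eqP c0.
by rewrite y_cz c0 scale0r eqxx in nz_y.
Qed.

(** * The matrix-tree theorem *)

Section MatrixTree.
Variables (G : multigraph) (r : vertex G).
Local Notation E := 'I_(num_edges G).
Local Notation W := #|predC1 r|.

(** The matrix is singular if T is disconnected (kernel vector: a potential) or
    contains a cycle (kernel vector: a flow); for a spanning tree, paths and
    fundamental cuts provide the inverse required by [det_sel_unimodular]. *)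
Lemma det_sel_incidence (T : {set E}) (B := incidence r int) :
  \det (block_mx (sel_mx int (~: T)) (sel_mx int T *m B^T) B 0)
  = (-1) ^+ W * (spanning_tree T)%:R.
Proof.
rewrite det_sel_sym /spanning_tree.
have [connT|discT] /= := boolP (connected_by T); last first.
  have [z nz_z zB] := disconnected_potential r discT.
  rewrite mulr0; apply/eqP/det0P; exists (row_mx 0 z).
    apply: contraNneq nz_z => /(congr1 rsubmx).
    by rewrite row_mxKr => ->; rewrite linear0.
  by rewrite mul_row_block zB !mul0mx mulmx0 !addr0 row_mx0.
have [acT|cycT] := boolP (acyclic T).
  have [P EP BP] := connected_path_matrix r connT.
  have [Phi PhiU] := acyclic_cut_matrix r acT.
  by rewrite (det_sel_unimodular EP BP PhiU) mulr1.
have [z [nz_z zE zB]] := cyclic_flow r cycT.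
rewrite mulr0; apply/eqP/det0P; exists (row_mx z 0).
  by apply: contraNneq nz_z => /(congr1 lsubmx); rewrite row_mxKl => ->; rewrite linear0.
rewrite mul_row_block !mul0mx !addr0 trmx_mul tr_sel_mx mulmxA zE zB.
by rewrite -zE -mulmxA sel_mxM setICr sel_mx0 mulmx0 row_mx0.
Qed.

Section Values.
Variable R : comNzRingType.

Definition kirchhoff_mx : 'M[R]_(num_edges G + W) :=
  block_mx 0 (incidence r R)^T (incidence r R) 0.

Definition tree_sum (x : {ffun E -> R}) : R :=
  \sum_(T : {set E} | spanning_tree T) \prod_(e | e \notin T) x e.

Lemma map_incidence : map_mx intr (incidence r int) = incidence r R.
Proof. by apply/matrixP => i e; rewrite !mxE rmorphB /= !natz !pmulrn. Qed.

Lemma map_sel_mx (T : {set E}) : map_mx intr (sel_mx int T) = sel_mx R T.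
Proof.
rewrite map_diag_mx; congr diag_mx; apply/rowP => e.
by rewrite !mxE natz pmulrn.
Qed.

Lemma matrix_tree (x : {ffun E -> R}) :
  \det (kirchhoff_mx + partial_diag W x) = (-1) ^+ W * tree_sum x.
Proof.
rewrite /kirchhoff_mx /partial_diag diag_mx_row raddf0 add_block_mx !addr0 add0r.
rewrite det_diag_expansion mulr_sumr [RHS]big_mkcond; apply: eq_bigr => T _ /=.
rewrite -map_incidence -!map_sel_mx matrix.map_trmx -map_mxM.
rewrite -[0](map_mx0 intr) -map_block_mx det_map_mx det_sel_incidence.
rewrite rmorphM rmorphXn rmorphN1 mulrC.
by case: spanning_tree; rewrite ?rmorph1 ?rmorph0 ?mulr1 ?mulr0 ?mul0r.
Qed.

Definition bump (x : {ffun E -> R}) e : {ffun E -> R} := [ffun f => x f + (f == e)%:R].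

Lemma partial_diag_bump x e :
  partial_diag W (bump x e)
  = partial_diag W x + delta_mx (lshift W e) (lshift W e).
Proof.
apply/matrixP => i j; rewrite !mxE; case: (split_ordP i) => k ->; rewrite !mxE.
  rewrite ffunE (inj_eq (@lshift_inj _ _)) mulrnDl; congr (_ + _).
  have [->|] := eqVneq k e; last by rewrite mul0rn.
  by rewrite eq_sym.
by rewrite eq_rlshift addr0.
Qed.

Lemma eval_monomial (x : {ffun E -> R}) (P : pred E) :
  (map_mpoly intr (\prod_(e | P e) 'X_e : {mpoly int[num_edges G]})).@[x]
  = \prod_(e | P e) x e.
Proof.
rewrite !rmorph_prod; apply: eq_bigr => e _ /=.
by rewrite (map_mpolyX (intmul 1)) mevalXU.
Qed.

Lemma eval_graph_poly (x : {ffun E -> R}) :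
  (map_mpoly intr (graph_poly G)).@[x] = tree_sum x.
Proof.
rewrite /graph_poly [map_mpoly _ _]rmorph_sum rmorph_sum.
by apply: eq_bigr => T _; apply: eval_monomial.
Qed.

Lemma mderiv_monomial_out n (e : 'I_n) (P : pred 'I_n) : ~~ P e ->
  (\prod_(f | P f) 'X_f : {mpoly int[n]})^`M(e) = 0.
Proof.
move=> nPe; apply: (big_ind (fun p : {mpoly int[n]} => p^`M(e) = 0)) => [|p q p0 q0|f Pf].
- exact: mderivC.
- by rewrite mderivM p0 q0 mul0r mulr0 addr0.
rewrite mderivX mnm1E; case: eqVneq Pf nPe => [-> ->//|_ _ _].
by rewrite scale0r.
Qed.

(** The graph polynomial is affine in each variable, so its derivatives are
    finite differences. *)
Lemma eval_mderiv_graph_poly (x : {ffun E -> R}) e :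
  (map_mpoly intr ((graph_poly G)^`M(e))).@[x] = tree_sum (bump x e) - tree_sum x.
Proof.
rewrite /graph_poly [mderiv _ _]linear_sum [map_mpoly _ _]rmorph_sum rmorph_sum -sumrB.
apply: eq_bigr => T _ /=.
have [eT|eT] := boolP (e \in T).
  rewrite mderiv_monomial_out ?eT // !rmorph0 -[LHS](subrr (\prod_(f | f \notin T) x f)).
  congr (_ - _); apply: eq_bigr => f fT; rewrite ffunE.
  by case: eqVneq fT => [->|]; rewrite ?eT ?addr0.
rewrite (bigD1 e) //= mderivM mderiv_monomial_out ?eqxx ?andbF // mulr0 addr0.
rewrite mderivX mnm1E eqxx scale1r -{1}[U_(e)%MM]add0m addmK mpolyX0 mul1r eval_monomial.
rewrite !(bigD1 (P := fun f => f \notin T) e) //= ffunE eqxx.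
rewrite [X in _ = _ * X - _](eq_bigr x) => [|f /andP[_ /negPf f_e]].
  by rewrite mulrDl mul1r addrAC subrr add0r.
by rewrite ffunE f_e addr0.
Qed.
End Values.
End MatrixTree.

(** * The singular locus as a rank condition *)

Section SingularLocus.
Variables (G : multigraph) (r : vertex G) (F : finFieldType).
Local Notation E := 'I_(num_edges G).
Local Notation W := #|predC1 r|.

Lemma kirchhoff_sym (x : {ffun E -> F}) :
  (kirchhoff_mx r F + partial_diag W x)^T = kirchhoff_mx r F + partial_diag W x.
Proof. by rewrite raddfD /= tr_block_mx trmxK !trmx0 tr_diag_mx. Qed.

(** A kernel vector of K that vanishes on the edges is a potential killed by the
    incidence matrix, hence zero because G is connected; so [corank_ge2E] applies
    with the edges as index set. *)
Lemma in_sing_locus (x : {ffun E -> F}) : connected_graph G ->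
  (x \in points (sing_locus G) F)
  = (\rank (kirchhoff_mx r F + partial_diag W x)%R + 2 <= num_edges G + W)%N.
Proof.
move=> connG; set K := kirchhoff_mx r F + partial_diag W x.
have detK e : \det (K + delta_mx (lshift W e) (lshift W e))
              = (-1) ^+ W * tree_sum (bump x e).
  by rewrite -matrix_tree partial_diag_bump addrA.
have sign_eq0 (a : F) : ((-1) ^+ W * a == 0) = (a == 0).
  by rewrite mulf_eq0 signr_eq0.
rewrite (@corank_ge2E _ _ _ [set lshift W e | e : E]) ?kirchhoff_sym //; last first.
  move=> z zK zE; have zl : lsubmx z = 0.
    by apply/rowP => e; rewrite !mxE zE // imset_f.
  rewrite -[z]hsubmxK zl (_ : rsubmx z = 0) ?row_mx0 //.
  apply: (connected_incidence_inj connG) => e _.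
  move: zK; rewrite -{1}[z]hsubmxK zl /K /kirchhoff_mx /partial_diag diag_mx_row raddf0.
  rewrite add_block_mx !addr0 mul_row_block !mul0mx mulmx0 add0r => /(congr1 lsubmx).
  by rewrite row_mxKl linear0 => /rowP/(_ e) ->; rewrite mxE.
rewrite inE /= matrix_tree sign_eq0 eval_graph_poly.
have [t0|//] := eqVneq (tree_sum x) 0; rewrite all_map /=.
apply/allP/forall_inP => [sing i /imsetP[e _ ->]|sing e _].
  have := sing e; rewrite mem_enum /= eval_mderiv_graph_poly t0 subr0 detK sign_eq0.
  exact.
rewrite /= eval_mderiv_graph_poly t0 subr0 -sign_eq0 -detK.
by apply: sing; rewrite imset_f.
Qed.
End SingularLocus.

(** * The theorem *)

Theorem theorem4 (G : multigraph) :
  connected_graph G -> (3 <= #|vertex G|)%N -> has_c_invariant 1 (sing_locus G).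
Proof.
move=> connG V3 F; rewrite expn1.
have /card_gt0P[r _] : (0 < #|vertex G|)%N by apply: leq_trans V3.
have W2 : (2 <= #|predC1 r|)%N by rewrite cardC1 -subn1 ltn_subRL.
(* Without edges the constant potential 1 would be killed by the incidence
   matrix. *)
have N_neq0 : num_edges G != 0%N.
  apply/eqP => N0.
  have /(_ (const_mx 1)) z0 := connected_incidence_inj (r := r) (R := int) connG.
  have /rowP/(_ (Ordinal (ltnW W2))) : const_mx 1 = 0 :> 'rV[int]_#|predC1 r|.
    by apply: z0 => e; have := ltn_ord e; rewrite {2}N0.
  by rewrite !mxE.
have F1 := card_finNzRing_gt1 F.
suff : #|points (sing_locus G) F|%:R = 0 :> 'Z_#|F|.
  by move/(congr1 val); rewrite /= val_Zp_nat // => /eqP.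
have K0 : drsubmx (kirchhoff_mx r F) = 0 by rewrite block_mxKdr.
have symK : (kirchhoff_mx r F)^T = kirchhoff_mx r F.
  by rewrite tr_block_mx trmxK !trmx0.
have := sum_corank_ge2 (pchar_Zp F1) W2 symK K0; rewrite (negPf N_neq0) => sum0.
apply: etrans sum0.
rewrite -sum1_card natr_sum big_mkcond; apply: eq_bigr => x _ /=.
by rewrite (in_sing_locus r _ connG); case: ifP.
Qed.
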